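(* Let $A,B\in\mathbb{S}^n$ be such that $A$ is invertible and $A^{-1}B$ has simple eigenvalues. Then $\{A,B\}$ is $d$-RSDC for any integer $d\geq 1$.
   Context: $\mathbb{S}^n$ denotes the real vector space of $n\times n$ real symmetric matrices. A matrix has simple eigenvalues if its (complex) eigenvalues all have algebraic multiplicity one. A set $\mathcal{A}\subseteq\mathbb{S}^n$ is simultaneously diagonalizable via congruence (SDC) if there exists an invertible $P\in\mathbb{R}^{n\times n}$ such that $P^\top A P$ is diagonal for all $A\in\mathcal{A}$. For an integer $d\ge 1$, a set $\mathcal{A}\subseteq\mathbb{S}^n$ is $d$-restricted SDC ($d$-RSDC) if there exist matrices $\bar A\in\mathbb{S}^{n+d}$, one for every $A\in\mathcal{A}$, with $\bar A$ containing $A$ as its top-left $n\times n$ principal submatrix, such that $\{\bar A: A\in\mathcal{A}\}$ is SDC. *)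

(* Defs.v *)
From HB Require Import structures.
From mathcomp Require Import all_boot all_order all_algebra.
From mathcomp Require Import classical_sets reals.
From mathcomp Require Import complex.

Set Implicit Arguments.
Unset Strict Implicit.
Unset Printing Implicit Defensive.

Import Order.TTheory GRing.Theory Num.Theory.

Local Open Scope classical_set_scope.
Local Open Scope ring_scope.

(* The real matrix is viewed in 'M[R[i]]_n so that all its complex
   eigenvalues are taken into account. *)
Definition simple_eigenvalues (R : realType) (n : nat) (M : 'M[R]_n) : Prop :=
  let MC := map_mx (real_complex R) M in
  forall z : R[i], eigenvalue MC z -> mup z (char_poly MC) = 1%N.

Definition SDC (R : realType) (n : nat) (S : set 'M[R]_n) : Prop :=
  exists2 P : 'M[R]_n, P \in unitmx &
    forall A, S A -> is_diag_mx (P^T *m A *m P).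

(* The choice of one extension for each element of S is a function [ext],
   whose values outside S are irrelevant. *)
Definition RSDC (R : realType) (n d : nat) (S : set 'M[R]_n) : Prop :=
  exists ext : 'M[R]_n -> 'M[R]_(n + d),
    (forall A, S A -> ext A \is symmetricmx /\ ulsubmx (ext A) = A) /\
    SDC (ext @` S).

(* Main.v *)
Require Import Defs.
From HB Require Import structures.
From mathcomp Require Import all_boot all_order all_algebra.
From mathcomp Require Import classical_sets reals.
From mathcomp Require Import complex.
From mathcomp Require Import ring.

Set Implicit Arguments.
Unset Strict Implicit.
Unset Printing Implicit Defensive.

Import Order.TTheory GRing.Theory Num.Theory.

Local Open Scope classical_set_scope.
Local Open Scope ring_scope.

(** Write M = A^-1 B.  The rows b_i with b_i M = l_i b_i are orthogonal for the
    bilinear form of A^-1, so that over the complex numbers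
      A = sum_i e_i b_i^T b_i   and   B = sum_i e_i l_i b_i^T b_i
    with e_i^-1 = b_i A^-1 b_i^T ([eigenbasis_decomposition]).

    Conversely, A and B have an SDC extension of size n + d as soon as they are
    real combinations of n + d common real rank-one matrices v^T v: stacking
    the vectors v gives an (n + d) x n matrix V of rank n with A = V^T D V and
    B = V^T E V for diagonal D and E, and completing V to an invertible matrix
    extends both factorizations ([rank_one_sum_dilation]).

    It remains to replace the complex decomposition by a real one with a single
    additional term.  A real eigenvalue already contributes a real rank-one
    term.  Let N be the set of the m nonreal eigenvalues, p the product of the
    X - l_i for i in N, and take any m + 1 distinct real nodes x_j.  With g the
    product of the X - x_j, the partial fraction expansion
      p(z) / g(z) = F(z) = sum_j w_j / (z - x_j)
    has real weights w_j, vanishes at each l_i and has a nonzero derivative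
    there, since the l_i are simple roots of p ([cauchy_weight_sums]).
    Therefore the Cauchy vectors v_j = sum_(i in N) b_i / (l_i - x_j) satisfy
      sum_j w_j v_j^T v_j = sum_(i in N) -F'(l_i) b_i^T b_i,
    and the same with the weights w_j x_j on the left and a factor l_i on the
    right ([cauchy_exchange]): for i <> k the cross term is a divided difference
    of F, which is zero.  Since nonreal eigenvectors can be rescaled by complex
    numbers, one may arrange that e_i = -F'(l_i) on N; choosing in addition the
    b_i compatible with complex conjugation ([equivariant_choice]) makes the
    v_j real.  Altogether n + 1 real rank-one terms are used, and zero terms
    fill up the remaining d - 1 places. *)

(** * Extensions from sums of rank-one matrices *)

Lemma tr_mul_diag_mul (K : comNzRingType) m n (V : 'M[K]_(m, n)) (c : 'rV_m) :
  V^T *m diag_mx c *m V = \sum_k c 0 k *: ((row k V)^T *m row k V).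
Proof.
apply/matrixP => i j; rewrite mul_mx_diag !mxE summxE; apply: eq_bigr => k _.
by rewrite !mxE big_ord1 !mxE mulrCA mulrA.
Qed.

(** Invertibility of A forces V to have full column rank, so V is the left block
    of an invertible Q; then Q^T D Q extends V^T D V and is diagonalized by the
    inverse of Q, whatever the diagonal D. *)
Lemma rank_one_sum_dilation (R : realType) n d (A B : 'M[R]_n)
    (V : 'M[R]_(n + d, n)) (a b : 'rV_(n + d)) :
  A \in unitmx -> A = V^T *m diag_mx a *m V -> B = V^T *m diag_mx b *m V ->
  RSDC d [set A; B].
Proof.
move=> Au defA defB.
have rV : \rank V = n.
  apply/eqP; rewrite eqn_leq rank_leq_col /=.
  by rewrite -{1}(mxrank_unit Au) {1}defA mxrankM_maxr.
have [Q [Qu VQ]] : exists Q : 'M[R]_(n + d), Q \in unitmx /\ lsubmx Q = V.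
  (* Gaussian elimination writes V as L (1 over 0) R with L and R invertible. *)
  exists (col_ebase V *m block_mx (row_ebase V) 0 0 1%:M); split.
    rewrite unitmx_mul col_ebase_unit unitmxE det_ublock det1 mulr1 -unitmxE.
    exact: row_ebase_unit.
  rewrite -[in RHS](mulmx_ebase V) rV pid_mx_col.
  rewrite -mulmxA mul_col_mx mul1mx mul0mx -mulmx_lsub; congr (_ *m _).
  by rewrite block_mxEh row_mxKl.
pose E c := Q^T *m diag_mx c *m Q.
have ulE c : ulsubmx (E c) = V^T *m diag_mx c *m V.
  rewrite /E -(hsubmxK Q) VQ tr_row_mx !mul_col_mx.
  by rewrite /ulsubmx col_mxKu mul_mx_row row_mxKl.
have symE c : E c \is symmetricmx.
  apply/sesquiP; rewrite expr0 scale1r map_mx_id //.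
  by rewrite /E !trmx_mul trmxK tr_diag_mx mulmxA.
exists (fun X => if X == A then E a else E b); split.
  move=> X [->|->]; first by rewrite eqxx ulE symE.
  by case: eqP => [->|_]; rewrite ulE symE.
exists (invmx Q); first by rewrite unitmx_inv.
have dE c : is_diag_mx ((invmx Q)^T *m E c *m invmx Q).
  by rewrite /E trmx_inv !mulmxA mulVmx ?unitmx_tr // mul1mx mulmxK.
by move=> _ [X _ <-]; case: ifP.
Qed.

(** * Partial fractions and Cauchy vectors *)

(** The residue at x j of the quotient of the product of the X - l i, i in N, by
    the product of the X - x k, for one more node than there are poles. *)
Definition cauchy_weight (K : fieldType) (x : nat -> K) (I : finType)
    (N : pred I) (l : I -> K) (j : 'I_#|N|.+1) : K :=
  (\prod_(i in N) (x j - l i)) / \prod_(k < #|N|.+1 | k != j) (x j - x k).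
Arguments cauchy_weight [K] x [I] N l j.

(** Lagrange interpolation of p = prod (X - l i) at the nodes is the partial
    fraction expansion of p / g with the denominators cleared.  Evaluating it
    and its derivative at the simple root l i of p gives both claims, the second
    sum being - p'(l i) / g(l i). *)
Lemma cauchy_weight_sums (K : fieldType) (x : nat -> K) (I : finType)
    (N : pred I) (l : I -> K) : injective x -> {in N &, injective l} ->
    (forall i j, i \in N -> l i != x j) -> forall i, i \in N ->
  \sum_j cauchy_weight x N l j / (l i - x j) = 0 /\
  \sum_(j < #|N|.+1) cauchy_weight x N l j / (l i - x j) ^+ 2 != 0.
Proof.
move=> x_inj l_inj l_x i iN.
pose p := \prod_(i in N) ('X - (l i)%:P).
pose G (j : 'I_#|N|.+1) := \prod_(k < #|N|.+1 | k != j) ('X - (x k)%:P).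
pose g := \prod_(k < #|N|.+1) ('X - (x k)%:P).
have gG (j : 'I_#|N|.+1) : g = ('X - (x j)%:P) * G j by rewrite /g (bigD1 j).
have p_dec : p = \sum_j cauchy_weight x N l j *: G j.
  have sp : (size p <= #|N|.+1)%N.
    by rewrite /p -big_enum size_prod_XsubC -cardE.
  rewrite {1}(lagrange_gen (ltn0Sn _) x_inj sp); apply: eq_bigr => j _.
  rewrite lagrangeE // mulrA -polyCM mul_polyC; congr (_ *: _).
  rewrite /cauchy_weight /p !horner_prod; congr (_ / _).
    by apply: eq_bigr => ? _; rewrite hornerXsubC.
  by apply: eq_bigr => ? _; rewrite hornerXsubC.
have zx j : l i - x j != 0 by rewrite subr_eq0 l_x.
have g_neq0 : g.[l i] != 0.
  by rewrite /g horner_prod; apply/prodf_neq0 => j _; rewrite hornerXsubC zx.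
have Gi j : (G j).[l i] = g.[l i] / (l i - x j).
  by rewrite (gG j) hornerM hornerXsubC mulrAC mulfV ?mul1r.
have dGi j : (G j)^`().[l i] =
    g^`().[l i] / (l i - x j) - g.[l i] / (l i - x j) ^+ 2.
  have := congr1 (fun q => q^`().[l i]) (gG j).
  rewrite derivM derivXsubC mul1r hornerD hornerM hornerXsubC Gi => ->.
  by field; rewrite zx.
have F0 : \sum_j cauchy_weight x N l j / (l i - x j) = 0.
  apply: (mulfI g_neq0); rewrite mulr0 mulr_sumr.
  have : p.[l i] = 0.
    by rewrite /p (bigD1 i) //= hornerM hornerXsubC subrr mul0r.
  rewrite p_dec horner_sum => {2}<-; apply: eq_bigr => j _.
  by rewrite hornerZ Gi mulrCA.
split=> //; have : p^`().[l i] != 0.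
  rewrite /p (bigD1 i) //= derivM derivXsubC mul1r hornerD hornerM.
  rewrite hornerXsubC subrr mul0r addr0 horner_prod.
  apply/prodf_neq0 => k /andP[kN ki]; rewrite hornerXsubC subr_eq0.
  by apply: contra ki => /eqP /l_inj ->.
rewrite p_dec (big_morph _ (@derivD _) (@deriv0 _)) horner_sum.
under eq_bigr => j _.
  rewrite derivZ hornerZ dGi mulrBr [_ * (g^`().[_] / _)]mulrCA.
  rewrite [_ * (g.[_] / _)]mulrCA; over.
rewrite sumrB -!mulr_sumr F0 mulr0 sub0r oppr_eq0 mulf_eq0 negb_or.
by case/andP.
Qed.

Lemma gram_sum (K : comNzRingType) (I J : finType) (N : pred I) n
    (b : I -> 'rV[K]_n) (t : J -> I -> K) (c : J -> K) (h : I -> K) :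
  (forall i k, i \in N -> k \in N ->
     \sum_j c j * (t j i * t j k) = (i == k)%:R * h i) ->
  let v j := \sum_(i in N) t j i *: b i in
  \sum_j c j *: ((v j)^T *m v j) = \sum_(i in N) h i *: ((b i)^T *m b i).
Proof.
move=> orth v; apply/matrixP => r s; rewrite !summxE.
transitivity (\sum_j \sum_(i in N) \sum_(k in N)
    (b i 0 r * b k 0 s) * (c j * (t j i * t j k))).
  apply: eq_bigr => j _; rewrite !mxE big_ord1 !mxE !summxE mulr_suml mulr_sumr.
  apply: eq_bigr => i _; rewrite !mulr_sumr; apply: eq_bigr => k _.
  by rewrite !mxE; ring.
rewrite exchange_big; apply: eq_bigr => i iN; rewrite exchange_big /=.
under eq_bigr => k kN do rewrite -mulr_sumr orth //.
rewrite (bigD1 i) //= eqxx mul1r big1 ?addr0 => [|k /andP[_ ki]].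
  by rewrite !mxE big_ord1 !mxE mulrC.
by rewrite eq_sym (negPf ki) mul0r mulr0.
Qed.

(** The partial fraction 1 / ((l i - x)(l k - x)) is a divided difference of
    1 / (l - x), so the vanishing of sum_j w j / (l - x j) at all l i makes the
    Cauchy vectors orthogonal; since x / (l - x) = l / (l - x) - 1, the weights
    w j * x j only multiply the result by l i. *)
Lemma cauchy_exchange (K : fieldType) (I J : finType) (N : pred I) n
    (b : I -> 'rV[K]_n) (l : I -> K) (x w : J -> K) :
  {in N &, injective l} -> (forall i j, i \in N -> l i != x j) ->
  (forall i, i \in N -> \sum_j w j / (l i - x j) = 0) ->
  let F i := \sum_j w j / (l i - x j) ^+ 2 in
  let v j := \sum_(i in N) (l i - x j)^-1 *: b i in
  \sum_j w j *: ((v j)^T *m v j) = \sum_(i in N) F i *: ((b i)^T *m b i) /\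
  \sum_j (w j * x j) *: ((v j)^T *m v j) =
    \sum_(i in N) (F i * l i) *: ((b i)^T *m b i).
Proof.
move=> l_inj l_x F0 F v.
have zx i j : i \in N -> l i - x j != 0 by move=> iN; rewrite subr_eq0 l_x.
have orth i k : i \in N -> k \in N ->
    \sum_j w j * ((l i - x j)^-1 * (l k - x j)^-1) = (i == k)%:R * F i.
  move=> iN kN; case: eqVneq => [<-|ik].
    by rewrite mul1r; apply: eq_bigr => j _; rewrite -invfM -expr2.
  have lik : l i - l k != 0.
    by rewrite subr_eq0; apply: contra ik => /eqP /l_inj ->.
  transitivity ((l i - l k)^-1 *
      (\sum_j w j / (l k - x j) - \sum_j w j / (l i - x j))).
    rewrite -sumrB mulr_sumr; apply: eq_bigr => j _.
    by field; rewrite lik !zx.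
  by rewrite !F0 // subrr mulr0 mul0r.
split; first exact: gram_sum orth.
apply: (@gram_sum _ _ _ _ _ b (fun j i => (l i - x j)^-1)) => i k iN kN.
transitivity (l i * (\sum_j w j * ((l i - x j)^-1 * (l k - x j)^-1)) -
    \sum_j w j / (l k - x j)).
  rewrite mulr_sumr -sumrB; apply: eq_bigr => j _.
  by field; rewrite !zx.
by rewrite F0 // subr0 orth // mulrCA [l i * _]mulrC.
Qed.

(** * Simultaneous diagonalization over a field *)

Lemma eigenrows_unit (K : fieldType) n (M : 'M[K]_n) (l : 'I_n -> K)
    (b : 'I_n -> 'rV_n) :
  injective l -> (forall i, b i != 0) -> (forall i, b i *m M = l i *: b i) ->
  \matrix_i b i \in unitmx.
Proof.
move=> l_inj b0 bM; rewrite -row_free_unit -kermx_eq0.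
apply/rowV0P => y /sub_kermxP yQ; apply/rowP => i; rewrite mxE.
have bE j : (y 0 j *: b j <= eigenspace M (l j))%MS.
  by apply/scalemx_sub/eigenspaceP.
have /mxdirect_sumsP/(_ i isT) dS : mxdirect (\sum_i eigenspace M (l i))%MS.
  by apply: mxdirect_sum_eigenspace => ? ? _ _ /l_inj.
have : (y 0 i *: b i <= (0 : 'M_n))%MS.
  rewrite -dS sub_capmx bE.
  have : \sum_j y 0 j *: b j = 0.
    by rewrite -[RHS]yQ mulmx_sum_row; apply: eq_bigr => j _; rewrite rowK.
  rewrite (bigD1 i) //= => /eqP; rewrite addr_eq0 => /eqP ->.
  by rewrite eqmx_opp; apply: summx_sub_sums => j _.
by rewrite submx0 scalemx_eq0 (negPf (b0 i)) orbF => /eqP.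
Qed.

(** The matrix D = Q A^-1 Q^T of the form A^-1 in the eigenbasis commutes with
    the diagonal matrix of the distinct eigenvalues because A^-1 B A^-1 is
    symmetric; hence D is diagonal, and A = Q^T D^-1 Q. *)
Lemma eigenbasis_decomposition (K : fieldType) n (A B : 'M[K]_n) (l : 'I_n -> K)
    (b : 'I_n -> 'rV_n) :
  A^T = A -> B^T = B -> A \in unitmx -> injective l -> (forall i, b i != 0) ->
  (forall i, b i *m (invmx A *m B) = l i *: b i) ->
  let e i := (b i *m invmx A *m (b i)^T) 0 0 in
  [/\ forall i, e i != 0,
      A = \sum_i (e i)^-1 *: ((b i)^T *m b i) &
      B = \sum_i ((e i)^-1 * l i) *: ((b i)^T *m b i)].
Proof.
move=> AT BT Au l_inj b0 bM e.
set M := invmx A *m B in bM; pose Q := \matrix_i b i.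
have rQ i : row i Q = b i by rewrite rowK.
have Qu : Q \in unitmx by apply: eigenrows_unit bM.
pose L := diag_mx (\row_i l i).
have QM : Q *m M = L *m Q.
  apply/row_matrixP => i; rewrite !row_mul rQ bM row_diag_mx mxE.
  by rewrite -scalemxAl -rowE rQ.
have AIT : (invmx A)^T = invmx A by rewrite trmx_inv AT.
pose D := Q *m invmx A *m Q^T.
have LD : L *m D = D *m L.
  have DT : D^T = D by rewrite /D !trmx_mul trmxK AIT mulmxA.
  have /(congr1 trmx) : L *m D = Q *m (M *m invmx A) *m Q^T.
    by rewrite /D !mulmxA -QM !mulmxA.
  rewrite trmx_mul tr_diag_mx DT => ->; rewrite /M !trmx_mul trmxK AIT BT.
  by rewrite /D !mulmxA -QM /M !mulmxA.
have D_diag : D = diag_mx (\row_i e i).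
  apply/matrixP => i j; rewrite !mxE; case: eqVneq => [<-|ij].
    rewrite mulr1n /e -rQ -!row_mul !mxE.
    by apply: eq_bigr => k _; rewrite !mxE.
  move/matrixP: LD => /(_ i j); rewrite mul_diag_mx mul_mx_diag !mxE mulrC.
  move/eqP; rewrite -subr_eq0 -mulrBr mulf_eq0 subr_eq0.
  by rewrite (inj_eq l_inj) (negPf ij) orbF mulr0n => /eqP ->.
have Du : D \in unitmx by rewrite !unitmx_mul unitmx_tr unitmx_inv Qu Au.
have e0 i : e i != 0.
  move: Du; rewrite D_diag unitmxE det_diag unitfE => /prodf_neq0 /(_ i isT).
  by rewrite mxE.
pose E := diag_mx (\row_i (e i)^-1).
have DE : D *m E = 1%:M.
  rewrite D_diag mulmx_diag -diag_const_mx; congr diag_mx.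
  by apply/rowP => i; rewrite !mxE mulfV.
have defA : A = Q^T *m E *m Q.
  have : invmx A *m (Q^T *m E *m Q) = 1%:M.
    apply: (can_inj (mulKmx Qu)); rewrite mulmx1 !mulmxA.
    by rewrite -/D DE mul1mx.
  by move/(congr1 (mulmx A)); rewrite mulKVmx // mulmx1.
have defB : B = Q^T *m (E *m L) *m Q.
  by rewrite -[LHS](mulKVmx Au) -/M {1}defA -!mulmxA QM.
split=> //.
  rewrite [LHS]defA tr_mul_diag_mul.
  by apply: eq_bigr => i _; rewrite rQ mxE.
rewrite defB mulmx_diag tr_mul_diag_mul.
by apply: eq_bigr => i _; rewrite rQ !mxE.
Qed.

(** * Complex conjugation *)

Lemma simple_spectrum_enum (C : numClosedFieldType) n (M : 'M[C]_n) :
  (forall z, eigenvalue M z -> mup z (char_poly M) = 1%N) ->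
  exists2 l : 'I_n -> C, injective l &
    forall z, eigenvalue M z <-> exists i, z = l i.
Proof.
move=> simple; have [s] := closed_field_poly_normal (char_poly M).
rewrite (monicP (char_poly_monic M)) scale1r => charE.
have ss : size s = n.
  by apply: succn_inj; rewrite -(size_char_poly M) charE size_prod_XsubC.
have eigE z : eigenvalue M z = (z \in s).
  by rewrite eigenvalue_root_char charE root_prod_XsubC.
have us : uniq s.
  apply: count_mem_uniq => z; rewrite -eigE.
  have [/simple|] := boolP (eigenvalue M z).
    by rewrite charE mu_prod_XsubC.
  by rewrite eigE => /count_memPn.
exists (fun i => s`_i).
  by move=> i j /eqP; rewrite nth_uniq ?ss ?ltn_ord // => /eqP /val_inj.
move=> z; rewrite eigE; split=> [zs|[i ->]]; last by rewrite mem_nth ?ss.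
have zi : (index z s < n)%N by rewrite -ss index_mem.
by exists (Ordinal zi); rewrite /= nth_index.
Qed.

(** Choose freely on one index of each orbit of the involution (the smaller one)
    and conjugate to obtain the other; a fixed index needs a real choice. *)
Lemma equivariant_choice (n m : nat) (C : numClosedFieldType)
    (s : 'I_m -> 'I_m) (P : 'I_m -> 'rV[C]_n -> Prop) :
  involutive s -> (forall i x, P i x -> P (s i) (map_mx Num.conj x)) ->
  (forall i, exists x, P i x /\ (s i = i -> map_mx Num.conj x = x)) ->
  exists b, forall i, P i (b i) /\ b (s i) = map_mx Num.conj (b i).
Proof.
move=> sK Pconj /fin_all_exists[x xP].
have conjK (y : 'rV[C]_n) : map_mx Num.conj (map_mx Num.conj y) = y.
  by rewrite -map_mx_comp map_mx_id //; apply: conjCK.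
exists (fun i : 'I_m =>
  if (i <= s i)%N then x i else map_mx Num.conj (x (s i))) => i.
rewrite sK; case: (ltngtP i (s i)) => [lt_is|lt_si|/val_inj eq_is].
- by have [] := xP i.
- split; last by rewrite conjK.
  by rewrite -{1}(sK i); apply: Pconj; have [] := xP (s i).
- by have [Pi xi] := xP i; rewrite -eq_is xi.
Qed.

(** A decomposition found over the complex numbers can be used as soon as each
    of its terms is real. *)
Lemma complex_rank_one_sum_dilation (R : realType) n d (A B : 'M[R]_n)
    (T : finType) (a b : T -> R[i]) (v : T -> 'rV[R[i]]_n) :
  A \in unitmx -> #|T| = (n + d)%N ->
  (forall t, (a t)^* = a t) -> (forall t, (b t)^* = b t) ->
  (forall t, map_mx Num.conj (v t) = v t) ->
  map_mx (real_complex R) A = \sum_t a t *: ((v t)^T *m v t) ->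
  map_mx (real_complex R) B = \sum_t b t *: ((v t)^T *m v t) ->
  RSDC d [set A; B].
Proof.
move=> Au cT aR bR vR defA defB.
pose f (k : 'I_(n + d)) : T := enum_val (cast_ord (esym cT) k).
have f_bij : bijective f.
  by exists (fun t => cast_ord cT (enum_rank t)) => z;
    rewrite /f ?enum_valK ?cast_ordKV ?cast_ordK ?enum_rankK.
pose V := \matrix_k map_mx (@complex.Re R) (v (f k)).
have ReK (z : R[i]) : z^* = z -> (complex.Re z)%:C%C = z.
  by move=> /CrealP /RRe_real.
have decomp (X : 'M[R]_n) (c : T -> R[i]) : (forall t, (c t)^* = c t) ->
    map_mx (real_complex R) X = \sum_t c t *: ((v t)^T *m v t) ->
    X = V^T *m diag_mx (\row_k complex.Re (c (f k))) *m V.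
  move=> cR defX; apply: (map_mx_inj (f := real_complex R)).
  rewrite defX tr_mul_diag_mul raddf_sum (reindex f) /=; last exact: onW_bij.
  have vE k : map_mx (real_complex R) (row k V) = v (f k).
    apply/rowP => i; rewrite !mxE; apply: ReK.
    by have /rowP/(_ i) := vR (f k); rewrite mxE.
  apply: eq_bigr => k _; rewrite map_mxZ mxE map_mxM -map_trmx vE.
  by congr (_ *: _); apply/esym/ReK.
exact: rank_one_sum_dilation Au (decomp _ _ aR defA) (decomp _ _ bR defB).
Qed.

Lemma conj_cauchy_weight (C : numClosedFieldType) (x : nat -> C) (I : finType)
    (N : pred I) (l : I -> C) (s : I -> I) (j : 'I_#|N|.+1) :
  (forall k, (x k)^* = x k) -> involutive s ->
  (forall i, (s i \in N) = (i \in N)) -> (forall i, l (s i) = (l i)^*) ->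
  (cauchy_weight x N l j)^* = cauchy_weight x N l j.
Proof.
move=> xR sK sN ls; rewrite rmorphM fmorphV !rmorph_prod; congr (_ / _).
  rewrite [RHS](reindex_inj (inv_inj sK)); apply: eq_big => i.
    by rewrite sN.
  by rewrite rmorphB /= xR ls.
by apply: eq_bigr => k _; rewrite rmorphB /= !xR.
Qed.

(** * The extension theorem *)

Theorem theorem5 (R : realType) (n : nat) (A B : 'M[R]_n)
    (hA : A \is symmetricmx) (hB : B \is symmetricmx)
    (hAunit : A \in unitmx)
    (hsimple : simple_eigenvalues (invmx A *m B))
    (d : nat) (hd : (1 <= d)%N) :
  RSDC d [set A; B].
Proof.
pose toC := real_complex R.
pose AC := map_mx toC A; pose BC := map_mx toC B.
have symC (X : 'M[R]_n) : X \is symmetricmx -> (map_mx toC X)^T = map_mx toC X.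
  by move/sesquiP; rewrite expr0 scale1r map_mx_id // map_trmx => <-.
have ACT : AC^T = AC := symC A hA; have BCT : BC^T = BC := symC B hB.
have ACu : AC \in unitmx by rewrite map_unitmx.
have conjR m (X : 'M[R]_(m, n)) : map_mx Num.conj (map_mx toC X) = map_mx toC X.
  apply/matrixP => i j; rewrite !mxE; apply/conj_Creal/complex_realP.
  by exists (X i j).
pose M := invmx AC *m BC.
have ME : M = map_mx toC (invmx A *m B) by rewrite map_mxM map_invmx.
have [l l_inj lP] : exists2 l : 'I_n -> R[i], injective l &
    forall z, eigenvalue M z <-> exists i, z = l i.
  by apply: simple_spectrum_enum => z; rewrite ME; apply: hsimple.
have eig_l i : eigenvalue M (l i) by apply/lP; exists i.
have /fin_all_exists[s ls] : forall i, exists k : 'I_n, l k = (l i)^*.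
  move=> i; have : eigenvalue M (l i)^*.
    by rewrite ME -(conjR _ _) eigenvalue_map -ME.
  by case/lP => k ->; exists k.
have sK : involutive s by move=> i; apply: l_inj; rewrite !ls conjCK.
pose N : pred 'I_n := fun i => s i != i.
have sN i : (s i \in N) = (i \in N).
  by rewrite !unfold_in /N sK eq_sym.
pose x (j : nat) : R[i] := j%:R.
have x_inj : injective x by move=> j k /eqP; rewrite eqr_nat => /eqP.
have xR j : (x j)^* = x j by rewrite conjC_nat.
have l_x i j : i \in N -> l i != x j.
  by apply: contraNneq => lx; apply/eqP/l_inj; rewrite ls lx xR.
have lN_inj : {in N &, injective l} by move=> i k _ _ /l_inj.
pose w := cauchy_weight x N l.
have wR j : (w j)^* = w j by apply: conj_cauchy_weight xR sK sN ls.
pose F i := \sum_j w j / (l i - x j) ^+ 2.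
have F0 i : i \in N -> \sum_j w j / (l i - x j) = 0.
  by move=> iN; have [] := cauchy_weight_sums x_inj lN_inj l_x iN.
have F_neq0 i : i \in N -> F i != 0.
  by move=> iN; have [] := cauchy_weight_sums x_inj lN_inj l_x iN.
have Fs i : F (s i) = (F i)^*.
  rewrite /F rmorph_sum; apply: eq_bigr => j _.
  by rewrite rmorphM fmorphV rmorphXn rmorphB /= wR xR ls.
pose e (y : 'rV[R[i]]_n) := (y *m invmx AC *m y^T) 0 0.
have eZ t y : e (t *: y) = t ^+ 2 * e y.
  by rewrite /e linearZ /= -!scalemxAl -scalemxAr !mxE mulrA.
have eJ y : e (map_mx Num.conj y) = (e y)^*.
  rewrite /e -[in LHS]map_invmx -(conjR _ (invmx A)) map_invmx.
  by rewrite -/AC map_trmx -!map_mxM mxE.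
pose P i y := [/\ y != 0, y *m M = l i *: y & i \in N -> e y * F i = 1].
have Pconj i y : P i y -> P (s i) (map_mx Num.conj y).
  case=> y0 yM ye; split; first by rewrite map_mx_eq0.
    by rewrite ls -map_mxZ -yM map_mxM ME conjR.
  by rewrite sN => /ye; rewrite eJ Fs -rmorphM => ->; rewrite rmorph1.
have [y yM y0] : exists2 y : 'I_n -> 'rV[R[i]]_n,
    forall i, y i *m M = l i *: y i & forall i, y i != 0.
  have : forall i, exists y : 'rV_n, y *m M = l i *: y /\ y != 0.
    by move=> i; have /eigenvalueP[y] := eig_l i; exists y.
  by case/fin_all_exists => y yP; exists y => i; case: (yP i).
(* Simple eigenvectors are not isotropic for A^-1, hence can be normalized. *)
have [e_neq0 _ _] := eigenbasis_decomposition ACT BCT ACu l_inj y0 yM.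
(* Nonreal eigenvectors are rescaled by a complex square root, so that the
   coefficient of b i in the decomposition of A becomes F i; for a real
   eigenvector the sign of e could forbid this, and its own rank-one term is
   kept instead. *)
have [b bP] : exists b, forall i, P i (b i) /\ b (s i) = map_mx Num.conj (b i).
  apply: (equivariant_choice sK Pconj) => i; have [iN|iN] := boolP (i \in N).
    exists (sqrtC ((F i * e (y i))^-1) *: y i); split; last first.
      by move/eqP; rewrite (negPf iN).
    have Fe0 : F i * e (y i) != 0 by rewrite mulf_neq0 ?F_neq0 ?e_neq0.
    split.
    - by rewrite scaler_eq0 sqrtC_eq0 invr_eq0 (negPf Fe0) (negPf (y0 i)).
    - by rewrite -scalemxAl yM !scalerA mulrC.
    - by move=> _; rewrite eZ sqrtCK mulrAC -mulrA mulVf.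
  have : l i \is Num.real.
    by apply/CrealP; rewrite -ls; congr l; apply/eqP; rewrite -[_ == _]negbK.
  case/complex_realP => r lr.
  have : eigenvalue (invmx A *m B) r.
    by have := eig_l i; rewrite lr ME eigenvalue_map.
  case/eigenvalueP => u uM u0; exists (map_mx toC u); split=> //; split.
  - by rewrite map_mx_eq0.
  - by rewrite ME -map_mxM uM map_mxZ lr.
  - by rewrite (negPf iN).
have bs i : b (s i) = map_mx Num.conj (b i) by case: (bP i).
have b0 i : b i != 0 by have [[]] := bP i.
have bM i : b i *m M = l i *: b i by have [[]] := bP i.
have bF i : i \in N -> (e (b i))^-1 = F i.
  have [[_ _ be] _] := bP i; move=> iN; have eb := be iN.
  have eb0 : e (b i) != 0.
    by apply: contra_eq_neq eb => ->; rewrite mul0r eq_sym oner_neq0.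
  by apply: (mulfI eb0); rewrite mulfV.
have [_ defA defB] := eigenbasis_decomposition ACT BCT ACu l_inj b0 bM.
pose v j := \sum_(i in N) (l i - x j)^-1 *: b i.
have [sumA sumB] :=
  @cauchy_exchange _ _ _ N _ b l (fun j : 'I_#|N|.+1 => x j) w lN_inj
    (fun i j => l_x i j) F0.
(* The Cauchy vectors of the nonreal eigenvalues, the eigenvectors of the real
   ones, and zero vectors: #|N|.+1 + (n - #|N|) + d.-1 = n + d terms. *)
pose K := predC N.
pose T := (('I_#|N|.+1 + 'I_#|K|) + 'I_d.-1)%type.
pose al (t : T) := match t with
  inl (inl j) => w j | inl (inr k) => (e (b (enum_val k)))^-1 | inr _ => 0 end.
pose be (t : T) := match t with
  inl (inl j) => w j * x j
  | inl (inr k) => (e (b (enum_val k)))^-1 * l (enum_val k) | inr _ => 0 end.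
pose vT (t : T) := match t with
  inl (inl j) => v j | inl (inr k) => b (enum_val k) | inr _ => 0 end.
have fixK i : i \in K -> s i = i by rewrite inE /= negbK => /eqP.
have lR i : i \in K -> (l i)^* = l i by move/fixK => {2}<-; rewrite ls.
have bR i : i \in K -> map_mx Num.conj (b i) = b i.
  by move/fixK => {2}<-; rewrite bs.
have eR i : i \in K -> ((e (b i))^-1)^* = (e (b i))^-1.
  by move=> iK; rewrite fmorphV /= -eJ bR.
apply: (@complex_rank_one_sum_dilation R n d A B T al be vT) => //.
- rewrite !card_sum !card_ord addSn cardC card_ord addSnnS prednK //.
- by case=> [[j|k]|z] /=; rewrite ?wR ?eR ?enum_valP ?rmorph0.
- case=> [[j|k]|z] /=; rewrite ?rmorph0 // rmorphM.
    by rewrite /= wR xR.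
  by rewrite /= eR ?lR ?enum_valP.
- case=> [[j|k]|z] /=; [|by rewrite bR ?enum_valP|by rewrite map_mx0].
  rewrite /v map_mx_sum [RHS](reindex_inj (inv_inj sK)).
  apply: eq_big => i; first by rewrite sN.
  by rewrite map_mxZ bs fmorphV rmorphB /= xR ls.
- rewrite !big_sumType /= [X in _ + X]big1 ?addr0 => [|? _];
    last by rewrite scale0r.
  rewrite sumA.
  rewrite -(big_enum_val (A := K) (fun i => (e (b i))^-1 *: ((b i)^T *m b i))).
  rewrite [LHS]defA (bigID (mem N)) /=; congr (_ + _).
  by apply: eq_bigr => i iN; congr (_ *: _); apply: bF.
- rewrite !big_sumType /= [X in _ + X]big1 ?addr0 => [|? _];
    last by rewrite scale0r.
  rewrite sumB -(big_enum_val (A := K)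
    (fun i => ((e (b i))^-1 * l i) *: ((b i)^T *m b i))).
  rewrite [LHS]defB (bigID (mem N)) /=; congr (_ + _).
  by apply: eq_bigr => i iN; congr (_ * _ *: _); apply: bF.
Qed.
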